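(* Let $k$ be a field and $H$ a quasi-Hopf algebra over $k$. Let $H_0$ be the $k$-vector space $H$ with the multiplication, left $H$-action and left $H$-coaction $$h\circ h'=\sum X^1hS(x^1X^2)\alpha x^2X^3_1h'S(x^3X^3_2),\qquad h\triangleright h'=\sum h_1h'S(h_2),$$ $$\lambda_{H_0}(h)=\sum h_{(-1)}\otimes h_{(0)}=\sum X^1Y^1_1h_1g^1S(q^2Y^2_2)Y^3\otimes X^2Y^1_2h_2g^2S(X^3q^1Y^2_1),$$ which make $H_0$ an algebra (with unit $\beta$) in the category ${}_H^H\mathcal{YD}$ of left Yetter-Drinfeld modules over $H$. Then $H_0$ is quantum commutative as an algebra in ${}_H^H\mathcal{YD}$, that is, for all $h,h'\in H$: $$h\circ h'=\sum (h_{(-1)}\triangleright h')\circ h_{(0)} .$$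
   Context: All tensor products are over the field $k$. A quasi-bialgebra is $(H,\Delta,\varepsilon,\Phi)$ where $H$ is an associative unital $k$-algebra, $\Phi\in H\otimes H\otimes H$ is invertible, and $\Delta:H\to H\otimes H$, $\varepsilon:H\to k$ are algebra maps such that, for all $h\in H$: $(id\otimes\Delta)(\Delta(h))=\Phi\,(\Delta\otimes id)(\Delta(h))\,\Phi^{-1}$; $(id\otimes\varepsilon)(\Delta(h))=h=(\varepsilon\otimes id)(\Delta(h))$; $(1\otimes\Phi)(id\otimes\Delta\otimes id)(\Phi)(\Phi\otimes 1)=(id\otimes id\otimes\Delta)(\Phi)(\Delta\otimes id\otimes id)(\Phi)$; $(id\otimes\varepsilon\otimes id)(\Phi)=1\otimes 1\otimes 1$. Notation: $\Delta(h)=\sum h_1\otimes h_2$; $\Phi=\sum X^1\otimes X^2\otimes X^3=\sum Y^1\otimes Y^2\otimes Y^3$, $\Phi^{-1}=\sum x^1\otimes x^2\otimes x^3$ (different letters denote independent copies); $\Delta(X^i)=\sum X^i_1\otimes X^i_2$, etc. A quasi-Hopf algebra is a quasi-bialgebra with an anti-automorphism $S$ of the algebra $H$ and $\alpha,\beta\in H$ such that for all $h$: $\sum S(h_1)\alpha h_2=\varepsilon(h)\alpha$, $\sum h_1\beta S(h_2)=\varepsilon(h)\beta$, $\sum X^1\beta S(X^2)\alpha X^3=1$, $\sum S(x^1)\alpha x^2\beta S(x^3)=1$. By rescaling, one assumes $\varepsilon(\alpha)=\varepsilon(\beta)=1$ and $\varepsilon\circ S=\varepsilon$. Elements used: $q_R=\sum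 q^1\otimes q^2=\sum X^1\otimes S^{-1}(\alpha X^3)X^2$. Put $\sum A^1\otimes A^2\otimes A^3\otimes A^4=(\Phi\otimes 1)(\Delta\otimes id\otimes id)(\Phi^{-1})$, $\sum B^1\otimes B^2\otimes B^3\otimes B^4=(\Delta\otimes id\otimes id)(\Phi)(\Phi^{-1}\otimes 1)$, $\gamma=\sum S(A^2)\alpha A^3\otimes S(A^1)\alpha A^4$, $\delta=\sum B^1\beta S(B^4)\otimes B^2\beta S(B^3)$. With $\Delta^{\rm op}(h)=\sum h_2\otimes h_1$, the (invertible) twist $f$ and its inverse are $$f=\sum (S\otimes S)(\Delta^{\rm op}(x^1))\,\gamma\,\Delta(x^2\beta S(x^3)),\qquad f^{-1}=\sum g^1\otimes g^2=\sum \Delta(S(x^1)\alpha x^2)\,\delta\,(S\otimes S)(\Delta^{\rm op}(x^3)).$$ The category ${}_H^H\mathcal{YD}$ has (pre)braiding $c_{M,N}(m\otimes n)=\sum m_{(-1)}\cdot n\otimes m_{(0)}$, where $m\mapsto\sum m_{(-1)}\otimes m_{(0)}$ is the left $H$-coaction of $M$; an algebra $A$ with multiplication $\underline m$ in a braided category is quantum commutative if $\underline m\circ c_{A,A}=\underline m$. *)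

(* Defs.v *)
From HB Require Import structures.
From mathcomp Require Import all_boot all_order all_algebra.
From mathcomp Require Import boolp classical_sets.
Set Implicit Arguments.
Unset Strict Implicit.
Unset Printing Implicit Defensive.
Import GRing.Theory.
Local Open Scope ring_scope.
Local Open Scope quotient_scope.

(* V ⊗ W is the set of formal sums of pairs (v, w), modulo the congruence
   generated by the bilinearity relations.  Formal sums carry no coefficients:
   a scalar is absorbed in either factor. *)
Section TensorRelation.
Variables (k : fieldType) (V W : lmodType k).

Inductive tensor_eq : seq (V * W) -> seq (V * W) -> Prop :=
| teq_refl s : tensor_eq s s
| teq_sym s t : tensor_eq s t -> tensor_eq t s
| teq_trans s t u : tensor_eq s t -> tensor_eq t u -> tensor_eq s u
| teq_cat s s' t t' :
    tensor_eq s s' -> tensor_eq t t' -> tensor_eq (s ++ t) (s' ++ t')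
| teq_comm s t : tensor_eq (s ++ t) (t ++ s)
| teq_zero w : tensor_eq [:: (0, w)] [::]
| teq_addl v v' w : tensor_eq [:: (v + v', w)] [:: (v, w); (v', w)]
| teq_addr v w w' : tensor_eq [:: (v, w + w')] [:: (v, w); (v, w')]
| teq_scale a v w : tensor_eq [:: (a *: v, w)] [:: (v, a *: w)].

Definition tensor_rel (s t : seq (V * W)) : bool := `[< tensor_eq s t >].

Lemma tensor_rel_refl : reflexive tensor_rel.
Proof. by move=> s; apply/asboolP; apply: teq_refl. Qed.

Lemma tensor_rel_sym : symmetric tensor_rel.
Proof. by move=> s t; apply/asboolP/asboolP; apply: teq_sym. Qed.

Lemma tensor_rel_trans : transitive tensor_rel.
Proof.
move=> t s u /asboolP st /asboolP tu; apply/asboolP; exact: teq_trans st tu.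
Qed.

Canonical tensor_equiv :=
  EquivRel tensor_rel tensor_rel_refl tensor_rel_sym tensor_rel_trans.

Definition tensor := {eq_quot tensor_equiv}.

HB.instance Definition _ := Choice.on tensor.

Definition tclass (s : seq (V * W)) : tensor := \pi_tensor s.
Definition tens (v : V) (w : W) : tensor := tclass [:: (v, w)].

(* Sweedler summation: the sum of F v_i w_i for t = \sum_i v_i ⊗ w_i.  It uses
   a chosen representative of t, and is independent of that choice, hence the
   linear map on V ⊗ W induced by F, as soon as F is bilinear: see tsum_tens
   and tsum_linear. *)
Definition tsum (U : lmodType k) (t : tensor) (F : V -> W -> U) : U :=
  \sum_(p <- repr t) F p.1 p.2.

Lemma tclassP s t : tclass s = tclass t <-> tensor_eq s t.
Proof.
split=> [/eqP|st]; first by rewrite eqmodE => /asboolP.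
by apply/eqP; rewrite eqmodE; apply/asboolP.
Qed.

Lemma tclass_repr t : tclass (repr t) = t. Proof. exact: reprK. Qed.

Lemma repr_tclass s : tensor_eq (repr (tclass s)) s.
Proof. by apply/tclassP; rewrite tclass_repr. Qed.

Lemma tensor_ex t : exists s, t = tclass s.
Proof. by exists (repr t); rewrite tclass_repr. Qed.

Let opp1 (p : V * W) : V * W := (- p.1, p.2).
Let scale1 (a : k) (p : V * W) : V * W := (a *: p.1, p.2).

Definition tzero : tensor := tclass [::].
Definition tadd (t u : tensor) : tensor := tclass (repr t ++ repr u).
Definition topp (t : tensor) : tensor := tclass [seq opp1 p | p <- repr t].
Definition tscale (a : k) (t : tensor) : tensor :=
  tclass [seq scale1 a p | p <- repr t].

Lemma tadd_class s t : tadd (tclass s) (tclass t) = tclass (s ++ t).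
Proof. by apply/tclassP; apply: teq_cat; apply: repr_tclass. Qed.

Lemma tensor_eq_scale a s t : tensor_eq s t ->
  tensor_eq [seq scale1 a p | p <- s] [seq scale1 a p | p <- t].
Proof.
elim=> {s t} /= [s|s t _|s t u _ IH1 _ IH2|s s' t t' _ IH1 _ IH2|s t|w|v v' w|v w w'|b v w].
- exact: teq_refl.
- exact: teq_sym.
- exact: teq_trans IH1 IH2.
- by rewrite !map_cat; apply: teq_cat.
- by rewrite !map_cat; apply: teq_comm.
- by rewrite /scale1 /= scaler0; apply: teq_zero.
- by rewrite /scale1 /= scalerDr; apply: teq_addl.
- exact: teq_addr.
- by rewrite /scale1 /= scalerA mulrC -scalerA; apply: teq_scale.
Qed.

Lemma opp1E (s : seq (V * W)) :
  [seq opp1 p | p <- s] = [seq scale1 (-1) p | p <- s].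
Proof. by apply: eq_map => p; rewrite /opp1 /scale1 scaleN1r. Qed.

Lemma topp_class s : topp (tclass s) = tclass [seq opp1 p | p <- s].
Proof.
by apply/tclassP; rewrite !opp1E; apply/tensor_eq_scale/repr_tclass.
Qed.

Lemma tscale_class a s : tscale a (tclass s) = tclass [seq scale1 a p | p <- s].
Proof. by apply/tclassP; apply/tensor_eq_scale/repr_tclass. Qed.

Lemma taddA : associative tadd.
Proof.
move=> t u v; have [[s ->] [s' ->] [s'' ->]] := And3 (tensor_ex t) (tensor_ex u) (tensor_ex v).
by rewrite !tadd_class catA.
Qed.

Lemma taddC : commutative tadd.
Proof.
move=> t u; have [[s ->] [s' ->]] := conj (tensor_ex t) (tensor_ex u).
by rewrite !tadd_class; apply/tclassP/teq_comm.
Qed.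

Lemma tadd0 : left_id tzero tadd.
Proof. by move=> t; have [s ->] := tensor_ex t; rewrite tadd_class. Qed.

Lemma tclass_cons p s : tclass (p :: s) = tadd (tens p.1 p.2) (tclass s).
Proof. by rewrite /tens tadd_class; case: p. Qed.

Lemma taddN : left_inverse tzero topp tadd.
Proof.
move=> t; have [s ->] := tensor_ex t.
rewrite topp_class; elim: s => [|[v w] s IH]; first by rewrite tadd0.
rewrite map_cons !tclass_cons /= taddA -(taddA (tens (- v) w)).
rewrite (taddC (tclass _)) taddA -taddA IH.
suff -> : tadd (tens (- v) w) (tens v w) = tzero by rewrite tadd0.
rewrite tadd_class; apply/tclassP; apply: (@teq_trans _ [:: (0, w)] _ _ (teq_zero w)).
by rewrite -[0 in X in tensor_eq _ X](addNr v); apply: teq_sym; apply: teq_addl.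
Qed.

HB.instance Definition _ :=
  GRing.isZmodule.Build tensor taddA taddC tadd0 taddN.

Lemma tclass0 : tclass [::] = 0. Proof. by []. Qed.
Lemma tclassD s t : tclass (s ++ t) = tclass s + tclass t.
Proof. by rewrite -tadd_class. Qed.

Lemma tclassE s : tclass s = \sum_(p <- s) tens p.1 p.2.
Proof.
elim: s => [|p s IH]; first by rewrite big_nil.
by rewrite big_cons -IH tclass_cons.
Qed.

Lemma tensDl v v' w : tens (v + v') w = tens v w + tens v' w.
Proof. by rewrite -tclassD; apply/tclassP/teq_addl. Qed.

Lemma tensDr v w w' : tens v (w + w') = tens v w + tens v w'.
Proof. by rewrite -tclassD; apply/tclassP/teq_addr. Qed.

Lemma tscaleDr : right_distributive tscale +%R.
Proof.
move=> a t u; have [[s ->] [s' ->]] := conj (tensor_ex t) (tensor_ex u).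
by rewrite -tclassD !tscale_class map_cat tclassD.
Qed.

Lemma tscale_tens a v w : tscale a (tens v w) = tens (a *: v) w.
Proof. by rewrite tscale_class. Qed.

Lemma tensor_ind (P : tensor -> Prop) :
    P 0 -> (forall v w, P (tens v w)) ->
    (forall t u, P t -> P u -> P (t + u)) -> forall t, P t.
Proof.
move=> P0 Pt PD t; have [s ->] := tensor_ex t; rewrite tclassE.
by elim/big_ind: _.
Qed.

Lemma tscale0 a : tscale a 0 = 0.
Proof. by apply: (addIr (tscale a 0)); rewrite -tscaleDr !add0r. Qed.

Lemma tscaleA a b t : tscale a (tscale b t) = tscale (a * b) t.
Proof.
elim/tensor_ind: t => [|v w|t u IHt IHu]; first by rewrite !tscale0.
  by rewrite !tscale_tens scalerA.
by rewrite !tscaleDr IHt IHu.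
Qed.

Lemma tscale1 : left_id 1 tscale.
Proof.
elim/tensor_ind=> [|v w|t u IHt IHu]; first by rewrite tscale0.
  by rewrite tscale_tens scale1r.
by rewrite tscaleDr IHt IHu.
Qed.

Lemma tscaleDl t : {morph tscale^~ t : a b / a + b}.
Proof.
move=> a b; elim/tensor_ind: t => [|v w|t u IHt IHu].
- by rewrite /= !tscale0 addr0.
- by rewrite /= !tscale_tens scalerDl tensDl.
- by rewrite /= in IHt IHu *; rewrite !tscaleDr IHt IHu addrACA.
Qed.

HB.instance Definition _ :=
  GRing.Zmodule_isLmodule.Build k tensor tscaleA tscale1 tscaleDr tscaleDl.

Lemma tensZl a v w : tens (a *: v) w = a *: tens v w.
Proof. by rewrite -tscale_tens. Qed.

Lemma tensZr a v w : tens v (a *: w) = a *: tens v w.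
Proof. by rewrite -tensZl; apply/esym/tclassP/teq_scale. Qed.

Lemma tens_bilinear : bilinear_for *:%R *:%R tens.
Proof.
by split=> [w|v] a x y /=; rewrite ?tensDl ?tensDr ?tensZl ?tensZr.
Qed.

HB.instance Definition _ :=
  @bilinear_isBilinear.Build k V W tensor *:%R *:%R tens tens_bilinear.

Section Universal.
Variables (U : lmodType k) (F : V -> W -> U).
Hypothesis bilF : bilinear_for *:%R *:%R F.

Let FDl v v' w : F (v + v') w = F v w + F v' w.
Proof. by have /= := bilF.1 w 1 v v'; rewrite !scale1r. Qed.
Let FDr v w w' : F v (w + w') = F v w + F v w'.
Proof. by have /= := bilF.2 v 1 w w'; rewrite !scale1r. Qed.
Let F0l w : F 0 w = 0.
Proof. by apply: (addIr (F 0 w)); rewrite -FDl !add0r. Qed.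
Let F0r v : F v 0 = 0.
Proof. by apply: (addIr (F v 0)); rewrite -FDr !add0r. Qed.
Let FZl a v w : F (a *: v) w = a *: F v w.
Proof. by have /= := bilF.1 w a v 0; rewrite !addr0 F0l addr0. Qed.
Let FZr a v w : F v (a *: w) = a *: F v w.
Proof. by have /= := bilF.2 v a w 0; rewrite !addr0 F0r addr0. Qed.

Lemma tensor_eq_sum s t : tensor_eq s t ->
  \sum_(p <- s) F p.1 p.2 = \sum_(p <- t) F p.1 p.2.
Proof.
elim=> {s t} /= [s|s t _|s t u _ IH1 _ IH2|s s' t t' _ IH1 _ IH2|s t|w|v v' w|v w w'|b v w].
- by [].
- by [].
- by rewrite IH1.
- by rewrite !big_cat /= IH1 IH2.
- by rewrite !big_cat /= addrC.
- by rewrite big_seq1 big_nil F0l.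
- by rewrite !big_cons !big_nil /= !addr0 FDl.
- by rewrite !big_cons !big_nil /= !addr0 FDr.
- by rewrite !big_seq1 /= FZl FZr.
Qed.

Lemma tsum_class s : tsum (tclass s) F = \sum_(p <- s) F p.1 p.2.
Proof. exact/tensor_eq_sum/repr_tclass. Qed.

Lemma tsum_tens v w : tsum (tens v w) F = F v w.
Proof. by rewrite tsum_class big_seq1. Qed.

Lemma tsumD t u : tsum (t + u) F = tsum t F + tsum u F.
Proof.
have [[s ->] [s' ->]] := conj (tensor_ex t) (tensor_ex u).
by rewrite -tclassD !tsum_class big_cat.
Qed.

Lemma tsum0 : tsum 0 F = 0.
Proof. by rewrite -tclass0 tsum_class big_nil. Qed.

Lemma tsumZ a t : tsum (a *: t) F = a *: tsum t F.
Proof.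
elim/tensor_ind: t => [|v w|t u IHt IHu]; first by rewrite scaler0 tsum0 scaler0.
  by rewrite -tensZl !tsum_tens FZl.
by rewrite scalerDr !tsumD IHt IHu scalerDr.
Qed.

Lemma tsum_linear : linear (fun t : tensor => tsum t F).
Proof. by move=> a t u; rewrite /= tsumD tsumZ. Qed.

End Universal.

End TensorRelation.

Arguments tens {k V W} v w.
Arguments tsum {k V W U} t F.

Notation "V ⊗ W" := (tensor V%type W%type)
  (at level 45, right associativity) : type_scope.
Notation "v ⊗ w" := (tens v w) (at level 45, right associativity) : ring_scope.

Notation "\tsum_ ( v , w <- t ) F" := (tsum t (fun v w => F))
  (at level 34, v name, w name, F at level 45,
   format "'[' \tsum_ ( v ,  w  <-  t ) '/  '  F ']'") : ring_scope.
Notation "\tsum_ ( u , v , w <- t ) F" :=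
  (tsum t (fun u t' => tsum t' (fun v w => F)))
  (at level 34, u name, v name, w name, F at level 45,
   format "'[' \tsum_ ( u ,  v ,  w  <-  t ) '/  '  F ']'") : ring_scope.
Notation "\tsum_ ( u , v , w , x <- t ) F" :=
  (tsum t (fun u t' => tsum t' (fun v t'' => tsum t'' (fun w x => F))))
  (at level 34, u name, v name, w name, x name, F at level 45,
   format "'[' \tsum_ ( u ,  v ,  w ,  x  <-  t ) '/  '  F ']'") : ring_scope.

(* Over a field, a nonzero vector is detected by a linear form; this is used to
   see that the algebra A ⊗ B is nonzero. *)
Section LinearForm.
Variables (k : fieldType) (V : lmodType k).

Lemma exists_linear_form (v : V) : v != 0 ->
  exists2 f : V -> k^o, linear f & f v = 1.
Proof.
move=> v0.
pose P (M : set V) :=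
  (forall a x y, M x -> M y -> M (a *: x + y)) /\ ~ M v.
have [F FP Ftot|M [[Mlin Mv] Mmax]] := @Zorn_bigcup V P.
  split=> [a x y [X FX Xx] [Y FY Yy]|[X FX Xv]]; last exact: (FP X FX).2.
  have [XY|YX] := Ftot X Y FX FY.
    by exists Y => //; apply: (FP Y FY).1 => //; apply: XY.
  by exists X => //; apply: (FP X FX).1 => //; apply: YX.
have M0 : M 0.
  apply: contrapT => nM0.
  have Mempty x : ~ M x.
    by move=> Mx; apply: nM0; rewrite -(addNr x) -scaleN1r; apply: Mlin.
  apply: (Mmax [set 0]%classic).
    split; first by move=> x /Mempty.
    by move=> /(_ 0 erefl).
  split=> [a x y -> ->|/= /eqP]; first by rewrite scaler0 addr0.
  by rewrite (negPf v0).
have MD x y : M x -> M y -> M (x + y) by move=> ? ?; rewrite -[x]scale1r; apply: Mlin.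
have MZ a x : M x -> M (a *: x) by move=> ?; rewrite -[_ *: _]addr0; apply: Mlin.
have Mex w : exists c : k, M (w - c *: v).
  have [Mw|nMw] := pselect (M w); first by exists 0; rewrite scale0r subr0.
  apply: contrapT => nex.
  apply: (Mmax [set x | exists2 m, M m & exists a, x = m + a *: w]%classic).
    split; first by move=> m Mm; exists m => //; exists 0; rewrite scale0r addr0.
    move=> /(_ w); apply: contra_not nMw => /(_ _)/=; apply.
    by exists 0 => //; exists 1; rewrite scale1r add0r.
  split=> [b x y [m Mm [a ->]] [m' Mm' [a' ->]]|[m Mm [a va]]].
    exists (b *: m + m'); first exact: Mlin.
    by exists (b * a + a'); rewrite scalerDr scalerDl scalerA addrACA.
  have [a0|a0] := eqVneq a 0.
    by apply: Mv; rewrite va a0 scale0r addr0.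
  apply: nex; exists a^-1.
  rewrite va scalerDr scalerA mulVf // scale1r opprD addrCA subrr addr0.
  by rewrite -scalerN; apply: (MZ); rewrite -scaleN1r; apply: (MZ).
pose f w : k^o := projT1 (cid (Mex w)).
have fP w : M (w - f w *: v) by rewrite /f; case: cid.
have Muniq w c : M (w - c *: v) -> f w = c.
  move=> Mc; apply: contrapT => /eqP; rewrite -subr_eq0 => fc.
  apply: Mv; rewrite -[v](scale1r) -(mulVf fc) -scalerA; apply: (MZ).
  have -> : (f w - c) *: v = (w - c *: v) - (w - f w *: v).
    by rewrite scalerBl opprB [RHS]addrC addrA subrK.
  by apply: MD => //; rewrite -scaleN1r; apply: (MZ).
exists f; last by apply: Muniq; rewrite scale1r subrr.
move=> a x y; apply: Muniq.
have -> : a *: x + y - (a *: f x + f y) *: v =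
          a *: (x - f x *: v) + (y - f y *: v).
  by rewrite scalerDl opprD addrACA scalerBr scalerA.
exact: Mlin.
Qed.

End LinearForm.

Lemma tens_neq0 (k : fieldType) (V W : lmodType k) (v : V) (w : W) :
  v != 0 -> w != 0 -> v ⊗ w != 0.
Proof.
move=> /exists_linear_form[f flin fv] /exists_linear_form[g glin gw].
pose F x y : k^o := f x * g y.
have bilF : bilinear_for *:%R *:%R F.
  split=> [y|x] a u u' /=; rewrite /F ?flin ?glin.
    by rewrite mulrDl -mulrA.
  by rewrite mulrDr /GRing.scale /= mulrCA.
apply/eqP => vw0; have := tsum_tens bilF v w; rewrite vw0 tsum0 //.
by rewrite /F fv gw mulr1 => /esym/eqP; rewrite oner_eq0.
Qed.

Section TensorAlgebra.
Variables (k : fieldType) (A B : algType k).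
Implicit Types (a : A) (b : B) (t u v : A ⊗ B).

Definition tone : A ⊗ B := 1 ⊗ 1.
Definition tmul t u : A ⊗ B :=
  \tsum_(a, b <- t) \tsum_(a', b' <- u) (a * a') ⊗ (b * b').

Let inner_bilinear a b :
  bilinear_for *:%R *:%R (fun a' b' => (a * a') ⊗ (b * b')).
Proof.
split=> [b'|a'] c x y /=.
  by rewrite mulrDr -scalerAr tensDl tensZl.
by rewrite mulrDr -scalerAr tensDr tensZr.
Qed.

Let outer_bilinear u :
  bilinear_for *:%R *:%R
    (fun a b => \tsum_(a', b' <- u) (a * a') ⊗ (b * b')).
Proof.
split=> [b|a] c x y /=; elim/tensor_ind: u => [|a' b'|t u IHt IHu].
- by rewrite !tsum0 // scaler0 addr0.
- by rewrite !tsum_tens // mulrDl -scalerAl tensDl tensZl.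
- by rewrite !tsumD // IHt IHu scalerDr addrACA.
- by rewrite !tsum0 // scaler0 addr0.
- by rewrite !tsum_tens // mulrDl -scalerAl tensDr tensZr.
- by rewrite !tsumD // IHt IHu scalerDr addrACA.
Qed.

Lemma tmul_tens a b a' b' : tmul (a ⊗ b) (a' ⊗ b') = (a * a') ⊗ (b * b').
Proof. by rewrite /tmul !tsum_tens. Qed.

Lemma tmulDl : left_distributive tmul +%R.
Proof. by move=> t u v; rewrite /tmul tsumD. Qed.

Lemma tmulZl c t u : c *: tmul t u = tmul (c *: t) u.
Proof. by rewrite /tmul tsumZ. Qed.

Lemma tmul0t t : tmul 0 t = 0.
Proof. by rewrite /tmul tsum0. Qed.

Lemma tmulDr : right_distributive tmul +%R.
Proof.
move=> t u v; elim/tensor_ind: t => [|a b|t t' IHt IHt'].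
- by rewrite !tmul0t addr0.
- by rewrite /tmul !tsum_tens // tsumD.
- by rewrite !tmulDl IHt IHt' addrACA.
Qed.

Lemma tmult0 t : tmul t 0 = 0.
Proof. by apply: (addIr (tmul t 0)); rewrite -tmulDr !add0r. Qed.

Lemma tmulZr c t u : c *: tmul t u = tmul t (c *: u).
Proof.
elim/tensor_ind: t => [|a b|t t' IHt IHt'].
- by rewrite !tmul0t scaler0.
- by rewrite /tmul !tsum_tens // tsumZ.
- by rewrite !tmulDl scalerDr IHt IHt'.
Qed.

Lemma tmulA : associative tmul.
Proof.
move=> t u v; elim/tensor_ind: t => [|a b|t t' IHt IHt'].
- by rewrite !tmul0t.
- elim/tensor_ind: u => [|a' b'|u u' IHu IHu'].
  + by rewrite !(tmul0t, tmult0).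
  + elim/tensor_ind: v => [|a'' b''|v v' IHv IHv'].
    * by rewrite !tmult0.
    * by rewrite !tmul_tens !mulrA.
    * by rewrite !tmulDr IHv IHv'.
  + by rewrite !(tmulDl, tmulDr) IHu IHu'.
- by rewrite !tmulDl IHt IHt'.
Qed.

Lemma tmul1t : left_id tone tmul.
Proof.
elim/tensor_ind=> [|a b|t u IHt IHu]; first exact: tmult0.
  by rewrite tmul_tens !mul1r.
by rewrite tmulDr IHt IHu.
Qed.

Lemma tmult1 : right_id tone tmul.
Proof.
elim/tensor_ind=> [|a b|t u IHt IHu]; first exact: tmul0t.
  by rewrite tmul_tens !mulr1.
by rewrite tmulDl IHt IHu.
Qed.

Lemma tone_neq0 : tone != 0.
Proof. by apply: tens_neq0; apply: oner_neq0. Qed.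

HB.instance Definition _ := GRing.Zmodule_isNzRing.Build (A ⊗ B)%type
  tmulA tmul1t tmult1 tmulDl tmulDr tone_neq0.
HB.instance Definition _ := GRing.Lmodule_isLalgebra.Build k (A ⊗ B)%type tmulZl.
HB.instance Definition _ := GRing.Lalgebra_isAlgebra.Build k (A ⊗ B)%type tmulZr.

Lemma tens1 : 1 ⊗ 1 = 1 :> A ⊗ B. Proof. by []. Qed.

Lemma tensM a b a' b' : (a ⊗ b) * (a' ⊗ b') = (a * a') ⊗ (b * b').
Proof. exact: tmul_tens. Qed.

End TensorAlgebra.

Record quasi_bialgebra (k : fieldType) (H : algType k) := QuasiBialgebra {
  Delta : {lrmorphism H -> H ⊗ H};
  eps : {lrmorphism H -> k | *%R};
  Phi : H ⊗ H ⊗ H;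
  Phi_inv : H ⊗ H ⊗ H;
  Phi_mulV : Phi * Phi_inv = 1;
  Phi_mulVl : Phi_inv * Phi = 1;
  Delta_coassoc h :
    \tsum_(h1, h2 <- Delta h) h1 ⊗ Delta h2 =
    Phi * (\tsum_(h1, h2 <- Delta h) \tsum_(h11, h12 <- Delta h1)
             h11 ⊗ h12 ⊗ h2) * Phi_inv;
  (* In the counit axioms the factor k is absorbed by scaling: H ⊗ k and k ⊗ H
     are identified with H, and H ⊗ k ⊗ H with H ⊗ H. *)
  Delta_counitr h : \tsum_(h1, h2 <- Delta h) eps h2 *: h1 = h;
  Delta_counitl h : \tsum_(h1, h2 <- Delta h) eps h1 *: h2 = h;
  Phi_cocycle :
    (1 ⊗ Phi)
      * (\tsum_(X1, X2, X3 <- Phi) \tsum_(X21, X22 <- Delta X2)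
           X1 ⊗ X21 ⊗ X22 ⊗ X3)
      * (\tsum_(X1, X2, X3 <- Phi) X1 ⊗ X2 ⊗ X3 ⊗ 1)
    = (\tsum_(X1, X2, X3 <- Phi) X1 ⊗ X2 ⊗ Delta X3)
      * (\tsum_(X1, X2, X3 <- Phi) \tsum_(X11, X12 <- Delta X1)
           X11 ⊗ X12 ⊗ X2 ⊗ X3);
  Phi_counit : \tsum_(X1, X2, X3 <- Phi) (eps X2 *: X1) ⊗ X3 = 1 ⊗ 1
}.

Record quasi_Hopf_algebra (k : fieldType) (H : algType k) := QuasiHopfAlgebra {
  qbialg :> quasi_bialgebra H;
  antipode : {linear H -> H};
  antipode_inv : H -> H;
  alpha : H;
  beta : H;
  antipodeK : cancel antipode antipode_inv;
  antipode_invK : cancel antipode_inv antipode;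
  antipode1 : antipode 1 = 1;
  antipodeM h h' : antipode (h * h') = antipode h' * antipode h;
  antipode_alpha h :
    \tsum_(h1, h2 <- Delta qbialg h) antipode h1 * alpha * h2
    = eps qbialg h *: alpha;
  antipode_beta h :
    \tsum_(h1, h2 <- Delta qbialg h) h1 * beta * antipode h2
    = eps qbialg h *: beta;
  Phi_antipode :
    \tsum_(X1, X2, X3 <- Phi qbialg)
      X1 * beta * antipode X2 * alpha * X3 = 1;
  Phi_inv_antipode :
    \tsum_(x1, x2, x3 <- Phi_inv qbialg)
      antipode x1 * alpha * x2 * beta * antipode x3 = 1;
  (* Normalization, which can always be achieved by rescaling alpha, beta. *)
  eps_alpha : eps qbialg alpha = 1;
  eps_beta : eps qbialg beta = 1;
  eps_antipode h : eps qbialg (antipode h) = eps qbialg h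
}.

Section H0.
Variables (k : fieldType) (H : algType k) (Q : quasi_Hopf_algebra H).

Local Notation Δ := (Delta Q).
Local Notation Φ := (Phi Q).
Local Notation Φi := (Phi_inv Q).
Local Notation S := (antipode Q).
Local Notation Si := (antipode_inv Q).
Local Notation α := (alpha Q).
Local Notation β := (beta Q).

Definition q_R : H ⊗ H :=
  \tsum_(X1, X2, X3 <- Φ) X1 ⊗ Si (α * X3) * X2.

Definition tensor_B : H ⊗ H ⊗ H ⊗ H :=
  (\tsum_(X1, X2, X3 <- Φ) \tsum_(X11, X12 <- Δ X1) X11 ⊗ X12 ⊗ X2 ⊗ X3)
  * (\tsum_(x1, x2, x3 <- Φi) x1 ⊗ x2 ⊗ x3 ⊗ 1).

Definition delta : H ⊗ H :=
  \tsum_(B1, B2, B3, B4 <- tensor_B) B1 * β * S B4 ⊗ B2 * β * S B3.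

(* The inverse f^-1 = \sum g1 ⊗ g2 of the Drinfeld twist f.  The last factor is
   (S ⊗ S)(Δ^op(x3)). *)
Definition twist_inv : H ⊗ H :=
  \tsum_(x1, x2, x3 <- Φi)
    Δ (S x1 * α * x2) * delta * (\tsum_(x31, x32 <- Δ x3) S x32 ⊗ S x31).

Definition H0_mul (h h' : H) : H :=
  \tsum_(X1, X2, X3 <- Φ) \tsum_(x1, x2, x3 <- Φi)
  \tsum_(X31, X32 <- Δ X3)
    X1 * h * S (x1 * X2) * α * x2 * X31 * h' * S (x3 * X32).

Definition H0_act (h h' : H) : H := \tsum_(h1, h2 <- Δ h) h1 * h' * S h2.

Definition H0_coact (h : H) : H ⊗ H :=
  \tsum_(X1, X2, X3 <- Φ) \tsum_(Y1, Y2, Y3 <- Φ)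
  \tsum_(Y11, Y12 <- Δ Y1) \tsum_(Y21, Y22 <- Δ Y2)
  \tsum_(h1, h2 <- Δ h) \tsum_(g1, g2 <- twist_inv) \tsum_(q1, q2 <- q_R)
    X1 * Y11 * h1 * g1 * S (q2 * Y22) * Y3
    ⊗ X2 * Y12 * h2 * g2 * S (X3 * q1 * Y21).

End H0.

(* The braiding c_{M,N} of Yetter-Drinfeld modules depends only on the
   coaction of M and on the action on N.  Here m' ⊗ m0 stands for the coaction
   m_(-1) ⊗ m_(0) of m. *)
Definition YD_braiding (k : fieldType) (H : algType k) (M N : lmodType k)
    (coactM : M -> H ⊗ M) (actN : H -> N -> N) (t : M ⊗ N) : N ⊗ M :=
  \tsum_(m, n <- t) \tsum_(m', m0 <- coactM m) actN m' n ⊗ m0.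

Definition quantum_commutative (k : fieldType) (H : algType k) (A : lmodType k)
    (act : H -> A -> A) (coact : A -> H ⊗ A) (mul : A -> A -> A) : Prop :=
  let m := fun t : A ⊗ A => \tsum_(a, b <- t) mul a b in
  m \o YD_braiding coact act =1 m.

(* Main.v *)
Require Import Defs.
From mathcomp Require Import all_boot all_algebra.
Import GRing.Theory.
Set Implicit Arguments.
Unset Strict Implicit.
Unset Printing Implicit Defensive.
Local Open Scope ring_scope.

(* Put phi(b) = X^1 b S(X^2) α X^3.  An element b of H_0 acts on an H-module by
   phi(b), and this action is H-linear: phi(h_1 ▷ b) h_2 = h phi(b).  The product
   is a ∘ c = phi(x^1 ▷ a) x^2 c S(x^3), and the coaction of h has the form
   X^1 T^1 ⊗ X^2 T^2 S(X^3); hence Φ cancels against Φ^-1 in the braided product,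
   which becomes Λ(T) = phi(T^1 ▷ h') T^2.  H-linearity says Λ(Δ(a) T) = a Λ(T),
   so the factors Δ(Y^1 h) of T and Δ(S(x^1) α x^2) of f^-1 can be pulled out
   (quantum commutativity is the naturality of the action of h' with respect to
   the action of h).  The remaining factors are evaluated with the cocycle
   identity and the relation Δ(q^1) p_R (1 ⊗ S(q^2)) = 1 ⊗ 1, where
   p_R = x^1 ⊗ x^2 β S(x^3). *)

(** * Linearity of Sweedler sums and reduction to pure tensors *)

Section Linear.
Variable k : fieldType.
Implicit Types (U V W : lmodType k) (A : algType k).

Lemma lin_id V : linear (fun x : V => x). Proof. by []. Qed.

Lemma lin_comp U V W (f : V -> W) (g : U -> V) :
  linear f -> linear g -> linear (fun x => f (g x)).
Proof. by move=> lf lg a x y; rewrite lg lf. Qed.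

Lemma lin_mull V A (f : V -> A) c : linear f -> linear (fun x => f x * c).
Proof. by move=> lf a x y; rewrite lf mulrDl scalerAl. Qed.

Lemma lin_mulr V A (f : V -> A) c : linear f -> linear (fun x => c * f x).
Proof. by move=> lf a x y; rewrite lf mulrDr scalerAr. Qed.

Lemma lin_tensl U V W (f : U -> V) (w : W) :
  linear f -> linear (fun x => f x ⊗ w).
Proof. by move=> lf a x y; rewrite lf tensDl tensZl. Qed.

Lemma lin_tensr U V W (f : U -> V) (w : W) :
  linear f -> linear (fun x => w ⊗ f x).
Proof. by move=> lf a x y; rewrite lf tensDr tensZr. Qed.

Lemma lin_scale U V (f : U -> V) c : linear f -> linear (fun x => c *: f x).
Proof. by move=> lf a x y; rewrite lf scalerDr !scalerA mulrC. Qed.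

Lemma lin_eps U V A (e : A -> k) (f : U -> A) (c : V) :
  scalar e -> linear f -> linear (fun x => e (f x) *: c).
Proof. by move=> le lf a x y; rewrite lf le scalerDl scalerA. Qed.

(** For fixed [t] the sum runs over one fixed representative, so it is a finite sum of linear
    maps. *)
Lemma lin_tsum U V W (X : lmodType k) (t : V ⊗ W) (F : U -> V -> W -> X) :
  (forall v w, linear (fun x => F x v w)) -> linear (fun x => tsum t (F x)).
Proof.
move=> lF a x y; rewrite /tsum scaler_sumr -big_split.
by apply: eq_bigr => p _; apply: lF.
Qed.

Lemma bilin U V W (F : V -> W -> U) :
  (forall w, linear (fun v => F v w)) -> (forall v, linear (fun w => F v w)) ->
  bilinear_for *:%R *:%R F.
Proof. by move=> l1 l2; split=> [w|v] a x y; [apply: l1|apply: l2]. Qed.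

Lemma lin_tsum_tensor U V W (X : lmodType k) (f : U -> V ⊗ W) (F : V -> W -> X) :
  linear f ->
  (forall w, linear (fun v => F v w)) -> (forall v, linear (fun w => F v w)) ->
  linear (fun x => tsum (f x) F).
Proof. by move=> lf l1 l2 a x y; rewrite lf tsum_linear //; apply: bilin. Qed.

Lemma tsumE U V W (v : V) (w : W) (F : V -> W -> U) :
  (forall w, linear (fun v => F v w)) -> (forall v, linear (fun w => F v w)) ->
  tsum (v ⊗ w) F = F v w.
Proof. by move=> l1 l2; apply/tsum_tens/bilin. Qed.

Lemma tens_ext U V W (f g : V ⊗ W -> U) :
  linear f -> linear g -> (forall v w, f (v ⊗ w) = g (v ⊗ w)) -> f =1 g.
Proof.
move=> lf lg fg.
have lin0 (h : V ⊗ W -> U) : linear h -> h 0 = 0.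
  by move=> lh; have := lh (-1) 0 0; rewrite !scaleN1r !addNr.
have linD (h : V ⊗ W -> U) : linear h -> {morph h : x y / x + y}.
  by move=> lh x y; have := lh 1 x y; rewrite !scale1r.
by elim/tensor_ind=> [|v w|t u IHt IHu]; rewrite ?lin0 ?linD ?IHt ?IHu.
Qed.

End Linear.

Create HintDb linear.

(** The match fails when the body mentions the bound variable, so [body] both tests for a constant
    function and extracts its value. *)
Ltac body f := match f with (fun _ => ?c) => constr:(c) end.
Ltac is_const f := let c := body f in idtac.

(* Linearity of multilinear Sweedler formulas; linearity of defined operations
   is looked up in the hint database. *)
Ltac lin :=
  intros; cbv beta;
  lazymatch goal with
  | |- GRing.linear_for _ (fun x => x) => exact: lin_id
  | |- GRing.linear_for _ (fun x => tsum (@?f x) (@?F x)) =>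
      tryif is_const f
      then let t := body f in refine (@lin_tsum _ _ _ _ _ t F _); lin
      else let F0 := body F in
           refine (@lin_tsum_tensor _ _ _ _ _ f F0 _ _ _); lin
  | |- GRing.linear_for _ (fun x => @?f x * @?g x) =>
      tryif is_const f
      then let c := body f in refine (@lin_mulr _ _ _ g c _); lin
      else let c := body g in refine (@lin_mull _ _ _ f c _); lin
  | |- GRing.linear_for _ (fun x => @?f x ⊗ @?g x) =>
      tryif is_const f
      then let c := body f in refine (@lin_tensr _ _ _ _ g c _); lin
      else let c := body g in refine (@lin_tensl _ _ _ _ f c _); lin
  | |- GRing.linear_for _ (fun x => @?c x *: @?g x) =>
      tryif is_const g
      then let v := body g in
           lazymatch c with
           | (fun x => ?e (@?f x)) =>
               refine (@lin_eps _ _ _ _ e f v _ _); [exact: linearP | lin]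
           end
      else let a := body c in refine (@lin_scale _ _ _ g a _); lin
  | |- GRing.linear_for _ (fun x => ?f (@?g x) (@?h x)) =>
      tryif is_const g
      then let c := body g in
           refine (@lin_comp _ _ _ _ (f c) h _ _);
           [by first [exact: linearP | auto with linear] | lin]
      else let c := body h in
           refine (@lin_comp _ _ _ _ (fun y => f y c) g _ _);
           [by auto with linear | lin]
  | |- GRing.linear_for _ (fun x => ?f (@?g x)) =>
      refine (@lin_comp _ _ _ _ f g _ _); [by auto with linear | lin]
  end.

(** Generalizes the tensor [t] and reduces the goal to pure tensors, after checking with [lin] that
    both sides are linear in [t]. *)
Ltac pure t :=
  move: t;
  lazymatch goal with |- forall t, @?f t = @?g t =>
    let lf := fresh in let lg := fresh in
    have lf : linear f; [lin | have lg : linear g; [lin |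
    refine (tens_ext lf lg _); clear lf lg; cbv beta]]
  end.
Ltac teval := repeat (rewrite tsumE; [|lin|lin]).

(** * Counit and cocycle identities in a quasi-bialgebra *)

Section QuasiBialgebra.
Variables (k : fieldType) (H : algType k) (Q : quasi_bialgebra H).
Local Notation H2 := (H ⊗ H)%type.
Local Notation H3 := (H ⊗ H ⊗ H)%type.
Local Notation H4 := (H ⊗ H ⊗ H ⊗ H)%type.
Local Notation Δ := (Delta Q).
Local Notation ε := (eps Q).
Local Notation Φ := (Phi Q).
Local Notation Φi := (Phi_inv Q).

Definition coprod1 (t : H3) : H4 :=
  \tsum_(X1, X2, X3 <- t) \tsum_(X11, X12 <- Δ X1) X11 ⊗ X12 ⊗ X2 ⊗ X3.
Definition coprod2 (t : H3) : H4 :=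
  \tsum_(X1, X2, X3 <- t) \tsum_(X21, X22 <- Δ X2) X1 ⊗ X21 ⊗ X22 ⊗ X3.
Definition coprod3 (t : H3) : H4 := \tsum_(X1, X2, X3 <- t) X1 ⊗ X2 ⊗ Δ X3.
Definition pad_right (t : H3) : H4 :=
  \tsum_(X1, X2, X3 <- t) X1 ⊗ X2 ⊗ X3 ⊗ (1 : H).

Definition counit2of4 (t : H4) : H3 :=
  \tsum_(a, b, c, d <- t) ε b *: (a ⊗ c ⊗ d).
Definition counit3of4 (t : H4) : H3 :=
  \tsum_(a, b, c, d <- t) ε c *: (a ⊗ b ⊗ d).
Definition counit1 (t : H3) : H2 := \tsum_(a, b, c <- t) ε a *: (b ⊗ c).
Definition counit2 (t : H3) : H2 := \tsum_(a, b, c <- t) ε b *: (a ⊗ c).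
Definition counit3 (t : H3) : H2 := \tsum_(a, b, c <- t) ε c *: (a ⊗ b).

Lemma DeltaM a b : Δ (a * b) = Δ a * Δ b. Proof. exact: rmorphM. Qed.
Lemma epsM a b : ε (a * b) = ε a * ε b. Proof. exact: rmorphM. Qed.
Lemma Delta1 : Δ 1 = 1 ⊗ 1. Proof. exact: rmorph1. Qed.
Lemma eps1 : ε 1 = 1. Proof. exact: rmorph1. Qed.

Lemma coprod1M t u : coprod1 (t * u) = coprod1 t * coprod1 u.
Proof.
rewrite /coprod1; pure t => a t; pure t => b c; pure u => a' u; pure u => b' c'.
rewrite !tensM; teval; rewrite DeltaM.
move: (Δ a) (Δ a') => s s'; pure s => ? ?; pure s' => ? ?.
by rewrite !tensM; teval; rewrite !tensM.
Qed.

Lemma coprod2M t u : coprod2 (t * u) = coprod2 t * coprod2 u.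
Proof.
rewrite /coprod2; pure t => a t; pure t => b c; pure u => a' u; pure u => b' c'.
rewrite !tensM; teval; rewrite DeltaM.
move: (Δ b) (Δ b') => s s'; pure s => ? ?; pure s' => ? ?.
by rewrite !tensM; teval; rewrite !tensM.
Qed.

Lemma coprod3M t u : coprod3 (t * u) = coprod3 t * coprod3 u.
Proof.
rewrite /coprod3; pure t => a t; pure t => b c; pure u => a' u; pure u => b' c'.
by rewrite !tensM; teval; rewrite DeltaM !tensM.
Qed.

Lemma pad_rightM t u : pad_right (t * u) = pad_right t * pad_right u.
Proof.
rewrite /pad_right; pure t => a t; pure t => b c.
pure u => a' u; pure u => b' c'.
by rewrite !tensM; teval; rewrite !tensM mulr1.
Qed.

Lemma counit2of4M t u : counit2of4 (t * u) = counit2of4 t * counit2of4 u.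
Proof.
rewrite /counit2of4; pure t => a t; pure t => b t; pure t => c d.
pure u => a' u; pure u => b' u; pure u => c' d'.
rewrite !tensM; teval; rewrite epsM -scalerAl -scalerAr scalerA.
by rewrite !tensM.
Qed.

Lemma counit3of4M t u : counit3of4 (t * u) = counit3of4 t * counit3of4 u.
Proof.
rewrite /counit3of4; pure t => a t; pure t => b t; pure t => c d.
pure u => a' u; pure u => b' u; pure u => c' d'.
rewrite !tensM; teval; rewrite epsM -scalerAl -scalerAr scalerA.
by rewrite !tensM.
Qed.

Lemma counit2M t u : counit2 (t * u) = counit2 t * counit2 u.
Proof.
rewrite /counit2; pure t => a t; pure t => b c; pure u => a' u; pure u => b' c'.
rewrite !tensM; teval; rewrite epsM -scalerAl -scalerAr scalerA.
by rewrite !tensM.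
Qed.

Lemma counit3M t u : counit3 (t * u) = counit3 t * counit3 u.
Proof.
rewrite /counit3; pure t => a t; pure t => b c; pure u => a' u; pure u => b' c'.
rewrite !tensM; teval; rewrite epsM -scalerAl -scalerAr scalerA.
by rewrite !tensM.
Qed.

Lemma cocycle : ((1 : H) ⊗ Φ) * coprod2 Φ * pad_right Φ = coprod3 Φ * coprod1 Φ.
Proof. exact: Phi_cocycle. Qed.

Lemma coprod1_1 : coprod1 1 = 1.
Proof. by rewrite -!tens1 /coprod1; teval; rewrite Delta1; teval. Qed.
Lemma coprod2_1 : coprod2 1 = 1.
Proof. by rewrite -!tens1 /coprod2; teval; rewrite Delta1; teval. Qed.
Lemma coprod3_1 : coprod3 1 = 1.
Proof. by rewrite -!tens1 /coprod3; teval; rewrite Delta1; teval. Qed.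
Lemma pad_right1 : pad_right 1 = 1 :> H4.
Proof. by rewrite -!tens1 /pad_right; teval. Qed.
Lemma counit2_1 : counit2 1 = 1.
Proof. by rewrite -!tens1 /counit2; teval; rewrite eps1 scale1r. Qed.
Lemma counit3_1 : counit3 1 = 1.
Proof. by rewrite -!tens1 /counit3; teval; rewrite eps1 scale1r. Qed.

Lemma counit2_Phi : counit2 Φ = 1.
Proof.
rewrite -tens1 -[RHS](Phi_counit Q); move: Φ => t; rewrite /counit2.
by pure t => a t; pure t => b c; teval; rewrite tensZl.
Qed.

Lemma counitr h : \tsum_(h1, h2 <- Δ h) ε h2 *: h1 = h.
Proof. exact: Delta_counitr. Qed.
Lemma counitl h : \tsum_(h1, h2 <- Δ h) ε h1 *: h2 = h.
Proof. exact: Delta_counitl. Qed.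

Lemma DeltaZ c a : Δ (c *: a) = c *: Δ a. Proof. exact: linearZ. Qed.

Lemma counit3of4_tens1 t : counit3of4 ((1 : H) ⊗ t) = (1 : H) ⊗ counit2 t.
Proof.
rewrite /counit3of4 /counit2; pure t => a t; pure t => b c.
by teval; rewrite tensZr.
Qed.
Lemma counit2of4_tens1 t : counit2of4 ((1 : H) ⊗ t) = (1 : H) ⊗ counit1 t.
Proof.
rewrite /counit2of4 /counit1; pure t => a t; pure t => b c.
by teval; rewrite tensZr.
Qed.
Lemma counit3of4_coprod2 t : counit3of4 (coprod2 t) = t.
Proof.
rewrite /counit3of4 /coprod2; pure t => a t; pure t => b c; teval.
rewrite -{2}[b]counitr.
by move: (Δ b) => s; pure s => ? ?; teval; rewrite tensZl tensZr.
Qed.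
Lemma counit2of4_coprod2 t : counit2of4 (coprod2 t) = t.
Proof.
rewrite /counit2of4 /coprod2; pure t => a t; pure t => b c; teval.
rewrite -{2}[b]counitl.
by move: (Δ b) => s; pure s => ? ?; teval; rewrite tensZl tensZr.
Qed.
Lemma counit3of4_coprod3 t : counit3of4 (coprod3 t) = t.
Proof.
rewrite /counit3of4 /coprod3; pure t => a t; pure t => b c; teval.
rewrite -{2}[c]counitl.
by move: (Δ c) => s; pure s => ? ?; teval; rewrite !tensZr.
Qed.
Lemma counit2of4_coprod1 t : counit2of4 (coprod1 t) = t.
Proof.
rewrite /counit2of4 /coprod1; pure t => a t; pure t => b c; teval.
rewrite -{2}[a]counitr.
by move: (Δ a) => s; pure s => ? ?; teval; rewrite !tensZl.
Qed.
(** Expressed through [counit2 t], so that for [t] = Φ the counit axiom reduces it to 1. *)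
Lemma counit3of4_coprod1 t : counit3of4 (coprod1 t) =
  \tsum_(a, b <- counit2 t) \tsum_(a1, a2 <- Δ a) a1 ⊗ a2 ⊗ b.
Proof.
rewrite /counit3of4 /coprod1 /counit2; pure t => a t; pure t => b c.
teval; rewrite -tensZl; teval.
rewrite DeltaZ; move: (Δ a) => s; pure s => ? ?.
by teval; rewrite -tensZl; teval; rewrite !tensZl.
Qed.
Lemma counit2of4_coprod3 t :
  counit2of4 (coprod3 t) = \tsum_(a, b <- counit2 t) a ⊗ Δ b.
Proof.
rewrite /counit2of4 /coprod3 /counit2; pure t => a t; pure t => b c.
teval; rewrite -tensZl; teval.
by move: (Δ c) => s; pure s => ? ?; teval; rewrite tensZl.
Qed.
Lemma counit3of4_pad t : counit3of4 (pad_right t) =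
  \tsum_(a, b <- counit3 t) a ⊗ b ⊗ (1 : H).
Proof.
rewrite /counit3of4 /pad_right /counit3; pure t => a t; pure t => b c.
by teval; rewrite -!tensZl; teval.
Qed.
Lemma counit2of4_pad t : counit2of4 (pad_right t) =
  \tsum_(a, b <- counit2 t) a ⊗ b ⊗ (1 : H).
Proof.
rewrite /counit2of4 /pad_right /counit2; pure t => a t; pure t => b c.
by teval; rewrite -!tensZl; teval.
Qed.

(** Applying ε to the third leg of the cocycle identity leaves Φ ([counit3 Φ] ⊗ 1) = Φ. Cancelling Φ
    and applying ε to the last leg gives the claim. *)
Lemma counit3_Phi : counit3 Φ = 1.
Proof.
have /(congr1 (fun t => Φi * t)) := congr1 counit3of4 cocycle.
rewrite !counit3of4M counit3of4_tens1 counit2_Phi counit3of4_coprod2.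
rewrite counit3of4_pad counit3of4_coprod3 counit3of4_coprod1 counit2_Phi.
rewrite -!tens1; teval; rewrite Delta1; teval.
rewrite !tens1 mul1r mulr1 mulrA Phi_mulVl mul1r.
move/(congr1 counit3); rewrite counit3_1 => <-.
move: (counit3 Φ) => s; rewrite /counit3; pure s => ? ?; teval.
by rewrite eps1 scale1r.
Qed.

(** Mirror argument: ε on the second leg of the cocycle identity leaves (1 ⊗ [counit1 Φ]) Φ = Φ. *)
Lemma counit1_Phi : counit1 Φ = 1.
Proof.
have /(congr1 (fun t => t * Φi)) := congr1 counit2of4 cocycle.
rewrite !counit2of4M counit2of4_tens1 counit2of4_coprod2.
rewrite counit2of4_pad counit2of4_coprod3 counit2of4_coprod1 counit2_Phi.
rewrite -!tens1; teval; rewrite Delta1; teval.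
rewrite !tens1 mul1r mulr1 -mulrA Phi_mulV mulr1.
move/(congr1 counit1); rewrite -!tens1 {1 3}/counit1; teval.
rewrite eps1 scale1r => <-.
by move: (counit1 Φ) => s; pure s => ? ?; teval; rewrite scale1r.
Qed.

Lemma counit2_Phi_inv : counit2 Φi = 1.
Proof. by rewrite -[LHS]mul1r -{1}counit2_Phi -counit2M Phi_mulV counit2_1. Qed.
Lemma counit3_Phi_inv : counit3 Φi = 1.
Proof. by rewrite -[LHS]mul1r -{1}counit3_Phi -counit3M Phi_mulV counit3_1. Qed.

Let tens1M (t u : H3) : ((1 : H) ⊗ t) * ((1 : H) ⊗ u) = (1 : H) ⊗ (t * u) :> H4.
Proof. by rewrite tensM mulr1. Qed.

(** The form of the cocycle identity that relates the two expressions [H0_mulE] and [H0_mul_expand]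
    of the product. *)
Lemma cocycle_pad_coprod1 :
  pad_right Φ * coprod1 Φi = coprod2 Φi * ((1 : H) ⊗ Φi) * coprod3 Φ.
Proof.
have := congr1 (fun t => coprod2 Φi * ((1 : H) ⊗ Φi) * t * coprod1 Φi) cocycle.
rewrite -!mulrA -!coprod1M Phi_mulV coprod1_1 mulr1 => <-.
by rewrite (mulrA ((1 : H) ⊗ Φi)) tens1M Phi_mulVl tens1 mul1r mulrA
  -coprod2M Phi_mulVl coprod2_1 mul1r.
Qed.

(** The form behind the relation [qR_pR] between q_R and p_R. *)
Lemma cocycle_coprod1_pad :
  coprod1 Φ * pad_right Φi = coprod3 Φi * ((1 : H) ⊗ Φ) * coprod2 Φ.
Proof.
have := congr1 (fun t => coprod3 Φi * t * pad_right Φi) cocycle.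
rewrite -!mulrA -!pad_rightM Phi_mulV pad_right1 mulr1 => ->.
by rewrite (mulrA (coprod3 Φi)) -coprod3M Phi_mulVl coprod3_1 mul1r.
Qed.

(** The form used to evaluate the inverse twist in [Lambda_twist]. *)
Lemma cocycle_coprod3_tens1 :
  coprod3 Φi * ((1 : H) ⊗ Φ) = coprod1 Φ * pad_right Φi * coprod2 Φi.
Proof.
by rewrite cocycle_coprod1_pad -mulrA -coprod2M Phi_mulV coprod2_1 mulr1.
Qed.

End QuasiBialgebra.

(** * The maps [phi] and [kappa] and their equivariance *)

Section QuasiHopf.
Variables (k : fieldType) (H : algType k) (Q : quasi_Hopf_algebra H).
Local Notation H2 := (H ⊗ H)%type.
Local Notation H3 := (H ⊗ H ⊗ H)%type.
Local Notation H4 := (H ⊗ H ⊗ H ⊗ H)%type.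
Local Notation Δ := (Delta Q).
Local Notation ε := (eps Q).
Local Notation Φ := (Phi Q).
Local Notation Φi := (Phi_inv Q).
Local Notation S := (antipode Q).
Local Notation Si := (antipode_inv Q).
Local Notation α := (alpha Q).
Local Notation β := (beta Q).
Local Notation Δ1 := (coprod1 Q).
Local Notation Δ2 := (coprod2 Q).
Local Notation Δ3 := (coprod3 Q).
Local Notation ε1 := (counit1 Q).
Local Notation ε2 := (counit2 Q).
Local Notation ε3 := (counit3 Q).
Local Notation SM := antipodeM.

(** [adj (Δ h) b] is the action h ▷ b; allowing any tensor in place of [Δ h] makes [adj]
    multiplicative in [t]. *)
Definition adj (t : H2) (b : H) : H := \tsum_(t1, t2 <- t) t1 * b * S t2.
Definition phi (t : H3) (b : H) : H :=
  \tsum_(X1, X2, X3 <- t) X1 * b * S X2 * α * X3.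
Definition kappa (t : H3) (b : H) : H :=
  \tsum_(x1, x2, x3 <- t) S x1 * α * x2 * b * S x3.

Lemma lin_adj t : linear (adj t). Proof. by rewrite /adj; lin. Qed.
Lemma lin_adj_l b : linear (fun t => adj t b). Proof. by rewrite /adj; lin. Qed.
Lemma lin_phi t : linear (phi t). Proof. by rewrite /phi; lin. Qed.
Lemma lin_phi_l b : linear (fun t => phi t b). Proof. by rewrite /phi; lin. Qed.
Lemma lin_kappa t : linear (kappa t). Proof. by rewrite /kappa; lin. Qed.
Lemma lin_kappa_l b : linear (fun t => kappa t b).
Proof. by rewrite /kappa; lin. Qed.
#[local] Hint Resolve lin_adj lin_adj_l lin_phi lin_phi_l lin_kappa
  lin_kappa_l : linear.

Lemma adjE u v b : adj (u ⊗ v) b = u * b * S v.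
Proof. by rewrite /adj; teval. Qed.
Lemma phiE u v w b : phi (u ⊗ v ⊗ w) b = u * b * S v * α * w.
Proof. by rewrite /phi; teval. Qed.
Lemma kappaE u v w b : kappa (u ⊗ v ⊗ w) b = S u * α * v * b * S w.
Proof. by rewrite /kappa; teval. Qed.

Lemma adjM t u b : adj (t * u) b = adj t (adj u b).
Proof.
pure t => a c; pure u => a' c'.
by rewrite tensM !adjE SM !mulrA.
Qed.

Lemma adj_beta h : adj (Δ h) β = ε h *: β.
Proof. exact: antipode_beta. Qed.

Definition coprod_left (s : H2) : H3 :=
  \tsum_(h1, h2 <- s) \tsum_(h11, h12 <- Δ h1) h11 ⊗ h12 ⊗ h2.
Definition coprod_right (s : H2) : H3 := \tsum_(h1, h2 <- s) h1 ⊗ Δ h2.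

Lemma coassoc h : coprod_right (Δ h) * Φ = Φ * coprod_left (Δ h).
Proof. by rewrite /coprod_right Delta_coassoc -mulrA Phi_mulVl mulr1. Qed.
Lemma coassoc_inv h : Φi * coprod_right (Δ h) = coprod_left (Δ h) * Φi.
Proof. by rewrite /coprod_right Delta_coassoc !mulrA Phi_mulVl mul1r. Qed.

Lemma phi_coprod_left t s b :
  phi (t * coprod_left s) b = \tsum_(h1, h2 <- s) phi t (adj (Δ h1) b) * h2.
Proof.
rewrite /coprod_left; pure s => u v; teval.
move: (Δ u) => r; pure r => p q; teval.
pure t => a t; pure t => c d.
by rewrite !tensM !phiE adjE SM !mulrA.
Qed.

Lemma phi_coprod_right t s b :
  phi (coprod_right s * t) b = \tsum_(h1, h2 <- s) ε h2 *: (h1 * phi t b).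
Proof.
rewrite /coprod_right; pure s => u v; teval; pure t => a t; pure t => c d.
rewrite phiE.
have -> : ε v *: (u * (a * b * S c * α * d))
          = u * a * b * S c * (ε v *: α) * d.
  by rewrite -scalerAr -scalerAl !mulrA.
rewrite -antipode_alpha; move: (Δ v) => r; pure r => p q.
by teval; rewrite !tensM phiE SM !mulrA.
Qed.

(** Quasi-coassociativity carries the coproducts of h from the right of Φ to its left, where S(h_1)
    α h_2 = ε(h) α collapses them. This is the H-linearity of the action of [b]. *)
Lemma phi_act h b :
  \tsum_(h1, h2 <- Δ h) phi Φ (adj (Δ h1) b) * h2 = h * phi Φ b.
Proof.
rewrite -phi_coprod_left -coassoc phi_coprod_right -{2}[h](counitr Q).
by move: (Δ h) => s; pure s => u v; teval; rewrite scalerAl.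
Qed.

Lemma kappa_coprod_right t s b :
  kappa (t * coprod_right s) b =
  \tsum_(h1, h2 <- s) S h1 * kappa t (adj (Δ h2) b).
Proof.
rewrite /coprod_right; pure s => u v; teval; move: (Δ v) => r; pure r => p q.
pure t => a t; pure t => c d.
by rewrite !tensM !kappaE adjE !SM !mulrA.
Qed.

Lemma kappa_coprod_left t s b :
  kappa (coprod_left s * t) b = \tsum_(h1, h2 <- s) ε h1 *: (kappa t b * S h2).
Proof.
rewrite /coprod_left; pure s => u v; teval; pure t => a t; pure t => c d.
rewrite kappaE.
have -> : ε u *: (S a * α * c * b * S d * S v)
          = S a * (ε u *: α) * c * b * S d * S v.
  by rewrite -scalerAr -!scalerAl.
rewrite -antipode_alpha; move: (Δ u) => r; pure r => p q.
by teval; rewrite !tensM kappaE !SM !mulrA.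
Qed.

(** Mirror of [phi_act] for Φ^-1; it lets a right factor [S h] be absorbed into [kappa]. *)
Lemma kappa_act h b :
  \tsum_(h1, h2 <- Δ h) S h1 * kappa Φi (adj (Δ h2) b) = kappa Φi b * S h.
Proof.
rewrite -kappa_coprod_right coassoc_inv kappa_coprod_left -{2}[h](counitl Q).
by move: (Δ h) => s; pure s => u v; teval; rewrite linearZ scalerAr.
Qed.

(** * The element p_R and its commutation with H *)

Definition pR (t : H3) : H2 := \tsum_(z1, z2, z3 <- t) z1 ⊗ (z2 * β * S z3).

Lemma pR_coprod_left s t : pR (coprod_left s * t) =
  \tsum_(y1, y2 <- s) \tsum_(z1, z2 <- Δ y1 * pR t) z1 ⊗ (z2 * S y2).
Proof.
rewrite /coprod_left /pR; pure s => u v; teval.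
move: (Δ u) => r; pure r => p q; teval.
pure t => a t; pure t => c d; rewrite !tensM.
by teval; rewrite !tensM; teval; rewrite SM !mulrA.
Qed.

Lemma pR_coprod_right s t : pR (t * coprod_right s) =
  \tsum_(y1, y2 <- s) \tsum_(z1, z2 <- pR t) ε y2 *: ((z1 * y1) ⊗ z2).
Proof.
rewrite /coprod_right /pR; pure s => u v; teval.
pure t => a t; pure t => c d; teval.
have -> : ε v *: ((a * u) ⊗ (c * β * S d))
          = (a * u) ⊗ (c * (ε v *: β) * S d).
  by rewrite -scalerAr -scalerAl tensZr.
rewrite -antipode_beta; move: (Δ v) => r; pure r => p q.
by rewrite !tensM; teval; rewrite SM !mulrA.
Qed.

(** The identity Δ(y_1) p_R (1 ⊗ S(y_2)) = p_R (y ⊗ 1): quasi-coassociativity moves the coproducts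
    to the right of Φ^-1, where h_1 β S(h_2) = ε(h) β applies. *)
Lemma pR_act y :
  \tsum_(y1, y2 <- Δ y) \tsum_(z1, z2 <- Δ y1 * pR Φi) z1 ⊗ (z2 * S y2)
  = \tsum_(z1, z2 <- pR Φi) (z1 * y) ⊗ z2.
Proof.
rewrite -pR_coprod_left -coassoc_inv pR_coprod_right -{2}[y](counitr Q).
move: (Δ y) (pR Φi) => s t; pure s => u v; pure t => z w.
by teval; rewrite -tensZl scalerAr.
Qed.

(** * First form of the product, and the relation between q_R and p_R *)

Lemma H0_mulE h h' : H0_mul Q h h' =
  \tsum_(X1, X2, X3 <- Φ) X1 * h * S X2 * kappa Φi (adj (Δ X3) h').
Proof.
rewrite /H0_mul; move: Φ Φi => t u; pure t => a t; pure t => b c.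
pure u => x u; pure u => y z; teval.
move: (Δ c) => r; pure r => p q; teval.
by rewrite adjE kappaE !SM !mulrA.
Qed.


(* The lemmas [_lhs] and [_rhs] evaluate one multilinear form on the two sides of
   a rearranged cocycle identity.  They are stated for arbitrary tensors in place
   of [Φ] and [Φi] so that they can be checked on pure tensors. *)
Lemma qR_pR_lhs t u :
  \tsum_(a, b, c, d <- Δ1 t * pad_right u) a ⊗ (b * β * S c * α * d) =
  \tsum_(X1, X2, X3 <- t) \tsum_(z1, z2 <- Δ X1 * pR u)
    z1 ⊗ (z2 * S X2 * α * X3).
Proof.
rewrite /coprod1 /pad_right /pR; pure t => a t; pure t => b c; teval.
move: (Δ a) => r; pure r => p q; teval.
pure u => x u; pure u => y z; teval; rewrite !tensM; teval.
by rewrite mulr1 SM !mulrA.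
Qed.

Lemma qR_pR_rhs t u v :
  \tsum_(a, b, c, d <- Δ3 t * ((1 : H) ⊗ u) * Δ2 v) a ⊗ (b * β * S c * α * d) =
  \tsum_(a, c <- ε3 t) \tsum_(p, q <- ε2 v) \tsum_(X1, X2, X3 <- u)
    (a * p) ⊗ (c * X1 * β * S X2 * α * X3 * q).
Proof.
rewrite /coprod3 /coprod2 /counit3 /counit2.
pure t => a t; pure t => b c; teval.
pure v => x v; pure v => y z; teval.
pure u => d u; pure u => f g; teval.
rewrite -!tensZl; teval.
(* The scalars ε(y) and ε(c) are moved onto β and α, where the antipode axioms turn them into y_1 β
   S(y_2) and S(c_1) α c_2. *)
have -> : (ε c *: a * (ε y *: x)) ⊗ (b * d * β * S f * α * g * z)
          = (a * x) ⊗ (b * d * (ε y *: β) * S f * (ε c *: α) * g * z).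
  by rewrite -!(scalerAl, scalerAr) !(tensZl, tensZr).
rewrite -antipode_alpha -antipode_beta.
move: (Δ c) (Δ y) => r s; pure r => c1 c2; pure s => y1 y2; teval.
by rewrite !tensM; teval; rewrite mulr1 !SM !mulrA.
Qed.

(** This is Δ(q^1) p_R (1 ⊗ S(q^2)) = 1 ⊗ 1, since S(q^2) = S(X^2) α X^3. After the cocycle identity
    the counits remove the outer Φ^-1 and Φ, and the middle Φ contributes X^1 β S(X^2) α X^3 = 1. *)
Lemma qR_pR :
  \tsum_(X1, X2, X3 <- Φ) \tsum_(z1, z2 <- Δ X1 * pR Φi)
    z1 ⊗ (z2 * S X2 * α * X3) = 1.
Proof.
rewrite -qR_pR_lhs cocycle_coprod1_pad qR_pR_rhs counit3_Phi_inv.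
rewrite counit2_Phi -!tens1; teval.
rewrite -[X in _ = _ ⊗ X](Phi_antipode Q); move: Φ => t.
pure t => a t; pure t => b c.
by teval; rewrite mulr1 mul1r mulr1.
Qed.

(** * Second form of the product, and the right unit β *)

Lemma H0_mul_lhs t u h h' :
  \tsum_(a, b, c, d <- pad_right t * Δ1 u) a * h * S b * α * c * h' * S d =
  \tsum_(x1, x2, x3 <- u) phi t (adj (Δ x1) h) * x2 * h' * S x3.
Proof.
rewrite /coprod1 /pad_right; pure u => x u; pure u => y z; teval.
move: (Δ x) => r; pure r => p q; teval.
pure t => a t; pure t => b c; teval; rewrite !tensM; teval.
by rewrite mul1r phiE adjE SM !mulrA.
Qed.

Lemma H0_mul_rhs t u v h h' :
  \tsum_(a, b, c, d <- Δ2 t * ((1 : H) ⊗ u) * Δ3 v)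
     a * h * S b * α * c * h' * S d =
  \tsum_(p, q <- ε2 t) p * (\tsum_(X1, X2, X3 <- v)
     X1 * h * S X2 * kappa u (adj (Δ X3) h')) * S q.
Proof.
rewrite /coprod3 /coprod2 /counit2.
pure t => a t; pure t => b c; teval.
pure v => x v; pure v => y z; teval.
pure u => d u; pure u => f g; teval.
rewrite -!tensZl; teval.
move: (Δ z) => r; pure r => z1 z2; rewrite adjE kappaE.
have -> : ε b *: a * (x * h * S y * (S d * α * f * (z1 * h' * S z2) * S g)) * S c
  = a * x * h * S y * S d * (ε b *: α) * f * z1 * h' * S z2 * S g * S c.
  by rewrite -!(scalerAl, scalerAr) !mulrA.
rewrite -antipode_alpha.
move: (Δ b) => s; pure s => b1 b2; teval.
by rewrite !tensM; teval; rewrite mulr1 !SM !mulrA.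
Qed.

Lemma H0_mul_expand h h' : H0_mul Q h h' =
  \tsum_(x1, x2, x3 <- Φi) phi Φ (adj (Δ x1) h) * x2 * h' * S x3.
Proof.
rewrite -H0_mul_lhs cocycle_pad_coprod1 H0_mul_rhs counit2_Phi_inv.
rewrite -H0_mulE -tens1; teval.
by rewrite antipode1 mul1r mulr1.
Qed.

Lemma kappaZ t c b : kappa t (c *: b) = c *: kappa t b.
Proof.
pure t => u t; pure t => v w.
by rewrite !kappaE -!(scalerAl, scalerAr).
Qed.

Lemma kappa_beta : kappa Φi β = 1.
Proof. exact: Phi_inv_antipode. Qed.

(** In [H0_mulE], X^3 ▷ β = ε(X^3) β and [kappa Φi β] = 1, so only [counit3 Φ] = 1 remains. *)
Lemma H0_mul_beta h : H0_mul Q h β = h.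
Proof.
rewrite H0_mulE.
transitivity (\tsum_(p, q <- ε3 Φ) p * h * S q).
  rewrite /counit3; move: Φ => t; pure t => a t; pure t => b c.
  teval; rewrite adj_beta kappaZ kappa_beta -tensZl; teval.
  by rewrite -!(scalerAl, scalerAr) mulr1.
by rewrite counit3_Phi -tens1; teval; rewrite antipode1 mul1r mulr1.
Qed.

(** * The map [Lambda] and its value on the inverse twist *)

Definition Lambda (b : H) (s : H2) : H :=
  \tsum_(T1, T2 <- s) phi Φ (adj (Δ T1) b) * T2.

Lemma lin_Lambda b : linear (Lambda b). Proof. by rewrite /Lambda; lin. Qed.
#[local] Hint Resolve lin_Lambda : linear.

Lemma Lambda_Delta a b s : Lambda b (Δ a * s) = a * Lambda b s.
Proof.
rewrite /Lambda; pure s => u v; teval; rewrite mulrA -phi_act.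
move: (Δ a) => r; pure r => p q.
by rewrite tensM; teval; rewrite DeltaM adjM !mulrA.
Qed.

Definition Sop (s : H2) : H2 := \tsum_(s1, s2 <- s) S s2 ⊗ S s1.

Lemma lin_Sop : linear Sop. Proof. by rewrite /Sop; lin. Qed.
#[local] Hint Resolve lin_Sop : linear.

Lemma SopM s t : Sop (s * t) = Sop t * Sop s.
Proof.
rewrite /Sop; pure s => a b; pure t => c d.
by rewrite tensM; teval; rewrite !SM tensM.
Qed.

(** Exhibits [Δ X1] as a left factor, which [Lambda_Delta] can pull out. *)
Lemma deltaE : delta Q =
  \tsum_(X1, X2, X3 <- Φ) Δ X1 * \tsum_(x1, x2, x3 <- Φi)
    ((x1 * β * S X3) ⊗ (x2 * β * S x3 * S X2)).
Proof.
transitivity (\tsum_(B1, B2, B3, B4 <- Δ1 Φ * pad_right Φi)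
                B1 * β * S B4 ⊗ B2 * β * S B3); first by [].
move: Φ Φi => t u; rewrite /coprod1 /pad_right; pure t => a t; pure t => b c.
pure u => x u; pure u => y z; teval.
move: (Δ a) => r; pure r => p q.
by teval; rewrite !tensM; teval; rewrite mulr1 SM !mulrA.
Qed.

Lemma Lambda_delta b m : Lambda b (delta Q * Sop m) =
  \tsum_(X1, X2, X3 <- Φ) \tsum_(m1, m2 <- m)
     X1 * adj (Δ (β * S X3 * S m2)) b * S X2 * S m1.
Proof.
pure m => m1 m2; rewrite deltaE; move: Φ => t.
pure t => X1 t; pure t => X2 X3; teval.
rewrite -(mulrA (Δ X1)) Lambda_Delta -!(mulrA X1); congr (_ * _).
(* Multiplying by the right unit β and expanding the product recreates the factors x^2 β S(x^3) of
   δ. *)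
rewrite -[adj _ b]H0_mul_beta H0_mul_expand.
move: Φi => u; pure u => x1 u; pure u => x2 x3.
rewrite /Sop; teval; rewrite tensM /Lambda; teval.
by rewrite -!mulrA [Δ (x1 * _)]DeltaM adjM !mulrA.
Qed.


Lemma twist_lhs t u b m1 m2 :
  \tsum_(a, b', c, d <- Δ3 t * ((1 : H) ⊗ u))
    S a * α * b' * adj (Δ (β * S (m2 * d))) b * S (m1 * c) =
  \tsum_(x1, x2, x3 <- t) S x1 * α * x2 *
    (\tsum_(X1, X2, X3 <- u) \tsum_(p, q <- (m1 ⊗ m2) * Δ x3)
       X1 * adj (Δ (β * S X3 * S q)) b * S X2 * S p).
Proof.
rewrite /coprod3; pure t => x1 t; pure t => x2 x3; teval.
move: (Δ x3) => r; pure r => p q.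
pure u => X1 u; pure u => X2 X3; teval.
rewrite !tensM; teval.
by rewrite mulr1 !SM !mulrA.
Qed.

Lemma twist_rhs t u v b m1 m2 :
  \tsum_(a, b', c, d <- Δ1 t * pad_right u * Δ2 v)
    S a * α * b' * adj (Δ (β * S (m2 * d))) b * S (m1 * c) =
  \tsum_(c, d <- ε1 t) \tsum_(z1, z2, z3 <- v)
    S z1 * kappa u (adj (Δ (z2 * β * S (m2 * d * z3))) b) * S (m1 * c).
Proof.
rewrite /coprod1 /coprod2 /pad_right /counit1.
pure t => X1 t; pure t => X2 X3; teval.
pure v => z1 v; pure v => z2 z3; teval.
rewrite -!tensZl; teval.
rewrite -(mulrA z2) DeltaM adjM; move: (Δ z2) => r; pure r => p q.
pure u => y1 u; pure u => y2 y3; teval; rewrite kappaE adjE.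
set w := adj _ b.
have -> : S z1 * (S y1 * α * y2 * (p * w * S q) * S y3) * S (m1 * (ε X1 *: X2))
  = S z1 * S y1 * (ε X1 *: α) * y2 * p * w * S q * S y3 * S X2 * S m1.
  by rewrite -!scalerAr linearZ SM -!(scalerAl, scalerAr) !mulrA.
rewrite -antipode_alpha; move: (Δ X1) => s; pure s => h1 h2; teval.
rewrite !tensM; teval.
by rewrite mulr1 (mulrA m2) -/w !SM !mulrA.
Qed.

(** Pull Δ(S(x^1) α x^2) out of f^-1, merge (S ⊗ S)(Δ^op(x^3)) with [Sop m], and evaluate δ by
    [Lambda_delta]. The cocycle identity then trades Φ^-1 and Φ for one Φ removed by ε, one Φ^-1
    forming [kappa] and one forming p_R. *)
Lemma Lambda_twist b m : Lambda b (twist_inv Q * Sop m) =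
  \tsum_(m1, m2 <- m) \tsum_(z1, z2 <- pR Φi)
    S z1 * kappa Φi (adj (Δ (z2 * S m2)) b) * S m1.
Proof.
have -> : Lambda b (twist_inv Q * Sop m) =
    \tsum_(x1, x2, x3 <- Φi) S x1 * α * x2 * Lambda b (delta Q * Sop (m * Δ x3)).
  rewrite /twist_inv; move: Φi => t; pure t => x1 t; pure t => x2 x3; teval.
  by rewrite -/(Sop _) -!(mulrA (Δ _)) Lambda_Delta SopM !mulrA.
pure m => m1 m2.
transitivity (\tsum_(x1, x2, x3 <- Φi) S x1 * α * x2 *
    (\tsum_(X1, X2, X3 <- Φ) \tsum_(p, q <- (m1 ⊗ m2) * Δ x3)
       X1 * adj (Δ (β * S X3 * S q)) b * S X2 * S p)).
  move: Φi => t; pure t => x1 t; pure t => x2 x3; teval.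
  by rewrite Lambda_delta.
rewrite -twist_lhs cocycle_coprod3_tens1 twist_rhs counit1_Phi -tens1; teval.
(* The copy of Φ^-1 inside [kappa] is hidden in an abstract linear map, so that only the copy in p_R
   is made pure. *)
rewrite /pR; move: (kappa Φi) (lin_kappa Φi) => K lK; move: Φi => v.
pure v => z1 v; pure v => z2 z3; teval.
by rewrite !mulr1 SM !mulrA.
Qed.

(** * Combining the inverse twist with q_R *)

Definition Theta (b : H) (s : H2) : H :=
  \tsum_(s1, s2 <- s) S s1 * kappa Φi (adj (Δ s2) b).

(** The trailing [S m1] passes through [kappa] by [kappa_act], which produces the factor [Δ m1] to
    the left of [p]. *)
Lemma Theta_kappa b m p :
  \tsum_(m1, m2 <- m) \tsum_(z1, z2 <- p)
    S z1 * kappa Φi (adj (Δ (z2 * S m2)) b) * S m1 =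
  Theta b (\tsum_(m1, m2 <- m) \tsum_(w1, w2 <- Δ m1 * p) w1 ⊗ (w2 * S m2)).
Proof.
rewrite /Theta; pure m => m1 m2; pure p => z1 z2; teval.
rewrite -mulrA -kappa_act; move: (Δ m1) => r; pure r => h1 h2.
by rewrite tensM; teval; rewrite -(mulrA h2) (DeltaM _ h2) adjM SM !mulrA.
Qed.

Lemma lin_Si : linear Si.
Proof.
move=> a x y; apply: (can_inj (antipodeK Q)).
by rewrite linearP !antipode_invK.
Qed.
#[local] Hint Resolve lin_Si : linear.

(** [pR_act] moves y to the right of p_R, and [qR_pR] evaluates what remains. *)
Lemma q_R_pR y :
  \tsum_(m1, m2 <- q_R Q * Δ y) \tsum_(w1, w2 <- Δ m1 * pR Φi)
    w1 ⊗ (w2 * S m2) = y ⊗ (1 : H).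
Proof.
transitivity (\tsum_(q1, q2 <- q_R Q) \tsum_(v1, v2 <- Δ q1 *
    (\tsum_(y1, y2 <- Δ y) \tsum_(w1, w2 <- Δ y1 * pR Φi) w1 ⊗ (w2 * S y2)))
      v1 ⊗ (v2 * S q2)).
  move: (q_R Q) (Δ y) (pR Φi) => q s p; pure q => q1 q2; pure s => y1 y2.
  rewrite tensM; teval; rewrite DeltaM.
  move: (Δ q1) (Δ y1) => r r'; pure p => p1 p2; pure r => a b; pure r' => c d.
  by rewrite !tensM; teval; rewrite !tensM; teval; rewrite SM !mulrA.
rewrite pR_act.
transitivity ((\tsum_(X1, X2, X3 <- Φ) \tsum_(z1, z2 <- Δ X1 * pR Φi)
    z1 ⊗ (z2 * S X2 * α * X3)) * (y ⊗ (1 : H)) : H2);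
  last by rewrite qR_pR mul1r.
rewrite /q_R; move: Φ (pR Φi) => t p; pure p => z1 z2.
pure t => X1 t; pure t => X2 X3; teval.
move: (Δ X1) => r; pure r => a b; rewrite !tensM; teval.
by rewrite tensM SM antipode_invK mulr1 !mulrA.
Qed.

Lemma Lambda_twist_q_R b y :
  Lambda b (twist_inv Q * Sop (q_R Q * Δ y)) = S y * kappa Φi b.
Proof.
rewrite Lambda_twist Theta_kappa q_R_pR /Theta; teval.
by rewrite Delta1 adjE mul1r antipode1 mulr1.
Qed.

(** * The coaction and the braided product *)

Lemma H0_coactE h : H0_coact Q h =
  \tsum_(X1, X2, X3 <- Φ) \tsum_(T1, T2 <-
    \tsum_(Y1, Y2, Y3 <- Φ) Δ (Y1 * h)
      * (twist_inv Q * Sop (q_R Q * Δ Y2)) * (Y3 ⊗ (1 : H)))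
    (X1 * T1) ⊗ (X2 * T2 * S X3).
Proof.
(* The selected occurrences are the outer copy X of Φ on each side. *)
rewrite /H0_coact; move: {1 3}Φ => t; pure t => X1 t; pure t => X2 X3; teval.
move: Φ (twist_inv Q) (q_R Q) => u g q.
pure u => Y1 u; pure u => Y2 Y3; teval; rewrite DeltaM /Sop.
move: (Δ Y1) (Δ Y2) (Δ h) => r s p; pure r => Y11 Y12; pure s => Y21 Y22.
pure p => h1 h2; pure g => g1 g2; pure q => q1 q2; teval.
rewrite !tensM; teval; rewrite !tensM; teval.
by rewrite mulr1 !SM !mulrA.
Qed.

Lemma Lambda_right b s c : Lambda b (s * (c ⊗ (1 : H))) = Lambda (adj (Δ c) b) s.
Proof.
rewrite /Lambda; pure s => u v; rewrite tensM; teval.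
by rewrite DeltaM adjM mulr1.
Qed.

Lemma lin_H0_mul_l b : linear (fun a => H0_mul Q a b).
Proof. by rewrite /H0_mul; lin. Qed.
Lemma lin_H0_mul a : linear (H0_mul Q a).
Proof. by rewrite /H0_mul; lin. Qed.
#[local] Hint Resolve lin_H0_mul lin_H0_mul_l : linear.

Lemma braided_mul_Lambda t h' :
  \tsum_(u, v <- \tsum_(X1, X2, X3 <- Φ) \tsum_(T1, T2 <- t)
      (X1 * T1) ⊗ (X2 * T2 * S X3)) H0_mul Q (adj (Δ u) h') v = Lambda h' t.
Proof.
pure t => T1 T2.
(* Expanding the product by [H0_mul_expand] puts Φ^-1 directly to the left of the outer Φ of the
   coaction, and the two cancel. *)
transitivity (\tsum_(a, b, c <- Φi * Φ)
    phi Φ (adj (Δ (a * T1)) h') * b * T2 * S c); last first.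
  rewrite Phi_mulVl -!tens1 /Lambda; teval.
  by rewrite antipode1 mul1r !mulr1.
(* Only the Φ of the coaction and the one in [Φi * Φ] are generalized; the Φ inside [phi] stays
   fixed. *)
rewrite /Lambda; move: {1 2}Φ => s.
pure s => X1 s; pure s => X2 X3; teval; rewrite H0_mul_expand.
move: Φi => u; pure u => x1 u; pure u => x2 x3; rewrite !tensM; teval.
by rewrite -(mulrA x1) [Δ (x1 * _)]DeltaM adjM SM !mulrA.
Qed.

(** The braided product is Λ(T). In it Y^1 h comes out on the left, Y^3 acts on h', and the twist
    with q_R leaves S(Y^2) κ, where κ is [kappa Φi]; the result is [H0_mulE]. *)
Lemma H0_mul_braided h h' :
  \tsum_(hm1, h0 <- H0_coact Q h) H0_mul Q (H0_act Q hm1 h') h0 = H0_mul Q h h'.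
Proof.
rewrite H0_coactE.
transitivity (\tsum_(Y1, Y2, Y3 <- Φ)
  Lambda h' (Δ (Y1 * h) * (twist_inv Q * Sop (q_R Q * Δ Y2)) * (Y3 ⊗ (1 : H)))).
  rewrite [LHS]braided_mul_Lambda.
  by move: Φ => s; pure s => Y1 s; pure s => Y2 Y3; teval.
rewrite H0_mulE; move: Φ => s; pure s => Y1 s; pure s => Y2 Y3; teval.
by rewrite Lambda_right Lambda_Delta Lambda_twist_q_R !mulrA.
Qed.

End QuasiHopf.

(** * Quantum commutativity, on tensors and on elements *)

Theorem proposition4p2 (k : fieldType) (H : algType k)
    (Q : quasi_Hopf_algebra H) :
  quantum_commutative (H0_act Q) (H0_coact Q) (H0_mul Q) /\
  (forall h h' : H,
    H0_mul Q h h' =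
    \tsum_(hm1, h0 <- H0_coact Q h) H0_mul Q (H0_act Q hm1 h') h0).
Proof.
split; last by move=> h h'; rewrite H0_mul_braided.
(* These linearity facts are put in the context for [lin], as the hints of the section are no longer
   available; they allow the reduction to pure tensors. *)
have lml b : linear (fun a => H0_mul Q a b) := @lin_H0_mul_l k H Q b.
have lmr a : linear (H0_mul Q a) := @lin_H0_mul k H Q a.
have lal b : linear (fun a => H0_act Q a b) by rewrite /H0_act; lin.
have lar a : linear (H0_act Q a) by rewrite /H0_act; lin.
have lc : linear (H0_coact Q) by rewrite /H0_coact; lin.
move=> t; rewrite /= /YD_braiding; pure t => h h'; teval.
rewrite -H0_mul_braided; move: (H0_coact Q h) => s; pure s => u v.
by teval.
Qed.
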